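(* Let $\mathcal{M}$ be a smooth manifold, and for $i\in\{1,2\}$ let $\{f_{i,j}\}_{j=1}^{d_i}$ be smooth vector fields on $\mathcal{M}$, $J_i:\mathcal{M}\to\mathbb{R}$ a smooth function, and $\kappa_i>0$. Let $\mathcal{U}\subset\mathcal{M}$ be an open submanifold such that, with $\mathcal{E}_i(x):=\mathrm{span}_{\mathbb{R}}\{f_{i,j}(x)\}_{j=1}^{d_i}$, each $\mathcal{E}_i$ is a regular distribution on $\mathcal{U}$, $T_x\mathcal{U}=\mathcal{E}_1(x)\oplus\mathcal{E}_2(x)$ for all $x\in\mathcal{U}$, and, for each $i$, the family $\{f_{i,j}\}_{j=1}^{d_i}$ is linearly independent at every $x\in\mathcal{U}$. Suppose that $x^\star\in\mathcal{U}$ is a locally exponentially stable equilibrium point of $$\dot{x}=\sum_{i=1}^2\kappa_i\sum_{j=1}^{d_i}L_{f_{i,j}}(J_i)(x)\,f_{i,j}(x).$$ Let $\Omega\subset\mathbb{R}^{d_1\times d_2}$ be an open neighborhood of $0$ and $X^\star:\Omega\to\mathcal{U}$ a smooth map with $X^\star(0)=x^\star$ such that, for every $\gamma\in\Omega$, $X^\star(\gamma)$ is a locally exponentially stable equilibrium point of $$\dot{x}=\sum_{i=1}^2\kappa_i\sum_{j=1}^{d_i}L_{\tilde f_{i,j}}(J_i)(x)\,\tilde f_{i,j}(x).$$ Then, under the identification of $T_{x^\star}\mathcal{U}$ with $\mathbb{R}^n$ ($n=d_1+d_2$) provided by the frame $\{f_{i,j}(x^\star)\}$, $$\frac{\partial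 X^\star}{\partial\gamma_j^k}\bigg|_{\gamma=0}=-\,dJ_2[f_{1,k}](x^\star)\,\big(A|_{x^\star}\big)^{-1}\big[f_{2,j}(x^\star)\big]$$ for all $j\in\{1,\dots,d_2\}$ and $k\in\{1,\dots,d_1\}$.
   Context: A regular distribution is a smooth distribution of constant rank. $L_fJ(x)=dJ(x)[f(x)]$. For a matrix $\gamma\in\mathbb{R}^{d_1\times d_2}$ with entries $\gamma_j^k$ ($k\in\{1,\dots,d_1\}$, $j\in\{1,\dots,d_2\}$), the tilted vector fields are $\tilde f_{1,j}:=f_{1,j}$ for $1\le j\le d_1$ and $\tilde f_{2,j}:=f_{2,j}+\sum_{k=1}^{d_1}\gamma_j^kf_{1,k}$ for $1\le j\le d_2$. $g$ is the Riemannian metric on $\mathcal{U}$ for which $\{f_{i,j}\}$ is an orthonormal frame, $\nabla$ its Levi-Civita connection, $\mathrm{grad}_{\mathcal{E}_i}(J)=P_{\mathcal{E}_i}\mathrm{grad}(J)=\sum_j dJ[f_{i,j}]f_{i,j}$ the $g$-orthogonal projection of the $g$-gradient onto $\mathcal{E}_i$, and $A$ the intrinsic Jacobian of the nominal dynamics, i.e. the $(1,1)$-tensor $A[X]:=\nabla_X\big(\sum_{i=1}^2\mathrm{grad}_{\mathcal{E}_i}(J_i)\big)$; $A|_{x^\star}:T_{x^\star}\mathcal{U}\to T_{x^\star}\mathcal{U}$ is its value at $x^\star$ (an invertible map under the stated hypotheses). *)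

(* Defs.v *)
From HB Require Import structures.
From mathcomp Require Import all_boot all_order all_algebra.
From mathcomp Require Import all_classical all_reals all_analysis.
Set Implicit Arguments.
Unset Strict Implicit.
Unset Printing Implicit Defensive.
Import Order.TTheory GRing.Theory Num.Theory.
Import numFieldNormedType.Exports.
Local Open Scope classical_set_scope.
Local Open Scope ring_scope.

Section SmoothCalculus.
Context {R : realType} {V W : normedModType R}.

(* [iter_derive [:: v1; ..; vk] f] is D_{v1} (.. (D_{vk} f)). *)
Definition iter_derive (s : seq V) (f : V -> W) : V -> W :=
  foldr (fun v h => fun x => 'D_v h x) f s.

(* C^infinity on D, for D open in a finite-dimensional V: all iterated
   directional derivatives exist and are Frechet differentiable on D. *)
Definition smooth_on (D : set V) (f : V -> W) : Prop :=
  forall (s : seq V) (x : V), D x -> differentiable (iter_derive s f) x.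

End SmoothCalculus.

(* Smooth m-dimensional manifolds (without boundary), given by an atlas indexed
   by [chart]; as a map, [inv i] is only meaningful on the image of [dom i].
   [chart_at] selects, once and for all, a chart around each point. *)
Record manifold (R : realType) (m : nat) := Manifold {
  carrier :> topologicalType ;
  hausdorff_carrier : hausdorff_space carrier ;
  second_countable_carrier : @second_countable carrier ;
  chart : Type ;
  dom : chart -> set carrier ;
  phi : chart -> carrier -> 'rV[R]_m ;
  inv : chart -> 'rV[R]_m -> carrier ;
  chart_at : carrier -> chart ;
  dom_chart_at : forall x, dom (chart_at x) x ;
  open_dom : forall i, open (dom i) ;
  open_phi_dom : forall i, open (phi i @` dom i) ;
  phiK : forall i x, dom i x -> inv i (phi i x) = x ;
  continuous_phi : forall i x, dom i x -> {for x, continuous (phi i)} ;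
  continuous_inv : forall i x, dom i x -> {for phi i x, continuous (inv i)} ;
  smooth_transition : forall i j,
    smooth_on (phi i @` (dom i `&` dom j)) (phi j \o inv i)
}.

Section Manifold.
Context {R : realType} {m : nat} {M : manifold R m}.

(* The tangent space at x is 'rV[R]_m for every x: a tangent vector is
   represented by its components in the chart [chart_at x], and
   [tangent_coord i x v] gives the components of v : T_x M in any chart i
   around x. *)
Notation T := 'rV[R]_m.

Definition tangent_coord (i : chart M) (x : M) (v : T) : T :=
  'D_v (phi i \o inv (chart_at x)) (phi (chart_at x) x).

(* A vector field assigns to each x an element of T_x M; [local_rep i X] is
   its expression in the chart i. *)
Definition vector_field := M -> T.

Definition local_rep (i : chart M) (X : vector_field) : T -> T :=
  fun y => tangent_coord i (inv i y) (X (inv i y)).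

Definition smooth_field (U : set M) (X : vector_field) : Prop :=
  forall i : chart M, smooth_on (phi i @` (dom i `&` U)) (local_rep i X).

Definition smooth_fun (U : set M) (h : M -> R) : Prop :=
  forall i : chart M, smooth_on (phi i @` (dom i `&` U)) (h \o inv i : T -> R).

Definition smooth_map {V : normedModType R} (D : set V) (c : V -> M) : Prop :=
  (forall y, D y -> {for y, continuous c}) /\
  forall i : chart M, smooth_on (D `&` c @^-1` dom i) (phi i \o c).

(* dh(x)[v] *)
Definition diff_fun (h : M -> R) (x : M) (v : T) : R :=
  'D_v (h \o inv (chart_at x) : T -> R) (phi (chart_at x) x).

(* L_X h *)
Definition lie_derivative (X : vector_field) (h : M -> R) : M -> R :=
  fun x => diff_fun h x (X x).

(* The derivative at y, in the direction w, of a map into M: a tangent vector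
   at c y. *)
Definition map_derive {V : normedModType R} (c : V -> M) (y w : V) : T :=
  'D_w (phi (chart_at (c y)) \o c) y.

Definition lie_bracket (X Y : vector_field) : vector_field := fun x =>
  let i := chart_at x in
  'D_(X x) (local_rep i Y) (phi i x) - 'D_(Y x) (local_rep i X) (phi i x).

Definition distribution := M -> {vspace T}.

Definition span_fields {d : nat} (f : 'I_d -> vector_field) : distribution :=
  fun x => <<[seq f j x | j : 'I_d]>>%VS.

Definition smooth_distribution (U : set M) (E : distribution) : Prop :=
  forall x, U x -> exists V : set M, [/\ open V, V x, V `<=` U &
    exists (r : nat) (X : 'I_r -> vector_field),
      (forall j, smooth_field V (X j)) /\
      (forall y, V y -> E y = span_fields X y)].

Definition regular_distribution (U : set M) (E : distribution) : Prop :=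
  smooth_distribution U E /\ exists r : nat, forall x, U x -> \dim (E x) = r.

Definition metric_tensor := M -> T -> T -> R.

Definition riemannian_metric (U : set M) (g : metric_tensor) : Prop :=
  [/\ forall x, U x -> forall (a : R) (u v w : T),
        g x (a *: u + v) w = a * g x u w + g x v w,
      forall x, U x -> forall u v : T, g x u v = g x v u,
      forall x, U x -> forall v : T, v != 0 -> 0 < g x v v &
      forall X Y, smooth_field U X -> smooth_field U Y ->
        smooth_fun U (fun x => g x (X x) (Y x))].

Definition orthonormal_frame (U : set M) (g : metric_tensor) {d1 d2 : nat}
    (f1 : 'I_d1 -> vector_field) (f2 : 'I_d2 -> vector_field) : Prop :=
  forall x, U x ->
  [/\ forall j k, g x (f1 j x) (f1 k x) = (j == k)%:R,
      forall j k, g x (f2 j x) (f2 k x) = (j == k)%:R &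
      forall j k, g x (f1 j x) (f2 k x) = 0].

(* [nabla Y x v] is the covariant derivative of Y at x in the direction
   v : T_x M, so that nabla_X Y is the field x |-> nabla Y x (X x). Only the
   values for x in U and Y smooth on U are constrained; the Leibniz rule for
   the indicator function of U makes them depend only on Y restricted to U. *)
Definition connection := vector_field -> forall x : M, T -> T.

Definition affine_connection (U : set M) (nabla : connection) : Prop :=
  [/\ forall Y x (a : R) (u v : T), smooth_field U Y -> U x ->
        nabla Y x (a *: u + v) = a *: nabla Y x u + nabla Y x v,
      forall Y Z x (v : T), smooth_field U Y -> smooth_field U Z -> U x ->
        nabla (fun y => Y y + Z y) x v = nabla Y x v + nabla Z x v,
      forall h Y x (v : T), smooth_fun U h -> smooth_field U Y -> U x ->
        nabla (fun y => h y *: Y y) x v =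
          diff_fun h x v *: Y x + h x *: nabla Y x v &
      forall X Y, smooth_field U X -> smooth_field U Y ->
        smooth_field U (fun x => nabla Y x (X x))].

Definition levi_civita (U : set M) (g : metric_tensor) (nabla : connection) :
    Prop :=
  [/\ affine_connection U nabla,
      forall X Y x (v : T), smooth_field U X -> smooth_field U Y -> U x ->
        diff_fun (fun y => g y (X y) (Y y)) x v =
          g x (nabla X x v) (Y x) + g x (X x) (nabla Y x v) &
      forall X Y x, smooth_field U X -> smooth_field U Y -> U x ->
        nabla Y x (X x) - nabla X x (Y x) = lie_bracket X Y x].

Definition grad (g : metric_tensor) (h : M -> R) : vector_field := fun x =>
  xget 0 [set w | forall v, g x w v = diff_fun h x v].

Definition orth_proj (g : metric_tensor) (E : distribution) (x : M) (v : T) :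
    T :=
  xget 0 [set w | w \in E x /\ forall u, u \in E x -> g x (v - w) u = 0].

Definition grad_along (g : metric_tensor) (E : distribution) (h : M -> R) :
    vector_field :=
  fun x => orth_proj g E x (grad g h x).

Definition intrinsic_jacobian (g : metric_tensor) (nabla : connection)
    (E1 E2 : distribution) (J1 J2 : M -> R) (x : M) : T -> T :=
  nabla (fun y => grad_along g E1 J1 y + grad_along g E2 J2 y) x.

Definition seeking_dynamics {d1 d2 : nat} (kappa1 kappa2 : R)
    (J1 J2 : M -> R) (f1 : 'I_d1 -> vector_field)
    (f2 : 'I_d2 -> vector_field) : vector_field := fun x =>
  kappa1 *: (\sum_(j < d1) lie_derivative (f1 j) J1 x *: f1 j x) +
  kappa2 *: (\sum_(j < d2) lie_derivative (f2 j) J2 x *: f2 j x).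

(* gamma_j^k is the entry [gamma k j]. *)
Definition tilt {d1 d2 : nat} (gamma : 'M[R]_(d1, d2))
    (f1 : 'I_d1 -> vector_field) (f2 : 'I_d2 -> vector_field) :
    'I_d2 -> vector_field :=
  fun j x => f2 j x + \sum_(k < d1) gamma k j *: f1 k x.

(* Solutions of dx/dt = F(x) on [0, +oo[ (values at t < 0 are irrelevant);
   continuity at 0 together with the equation for t > 0 gives the right
   derivative F (c 0) at t = 0. *)
Definition forward_solution (F : vector_field) (c : R -> M) : Prop :=
  {within `[0, +oo[, continuous c} /\
  forall t : R, 0 < t ->
    is_derive t 1 (phi (chart_at (c t)) \o c : R -> T) (F (c t)).

(* The distance is measured in a chart around x: coordinate distances in two
   charts (or the coordinate and a Riemannian distance) are equivalent near x,
   so the notion does not depend on this choice. *)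
Definition locally_exp_stable (F : vector_field) (x : M) : Prop :=
  F x = 0 /\
  exists (V : set M) (C lambda : R),
  [/\ nbhs x V, 0 < C, 0 < lambda &
  forall x0, V x0 ->
    (exists c, forward_solution F c /\ c 0 = x0) /\
    forall c, forward_solution F c -> c 0 = x0 ->
    let i := chart_at x in
    forall t : R, 0 <= t ->
      dom i (c t) /\
      `|phi i (c t) - phi i x| <=
        C * expR (- lambda * t) * `|phi i x0 - phi i x|].

End Manifold.

Arguments vector_field {R m} M.
Arguments distribution {R m} M.
Arguments metric_tensor {R m} M.
Arguments connection {R m} M.

(* Main.v *)
Require Import Defs.
From HB Require Import structures.
From mathcomp Require Import all_boot all_order all_algebra.
From mathcomp Require Import all_classical all_reals all_analysis.
From mathcomp Require Import ring lra.
Set Implicit Arguments.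
Unset Strict Implicit.
Unset Printing Implicit Defensive.
Import Order.TTheory GRing.Theory Num.Theory.
Import numFieldNormedType.Exports.
Local Open Scope classical_set_scope.
Local Open Scope ring_scope.

(** Write a_k = L_{f_{1,k}} J_1, b_j = L_{f_{2,j}} J_2, c_k = L_{f_{1,k}} J_2.
    Everything is read off these coefficient functions.

    The tilted frame spans the tangent space as well as the original one, so an
    equilibrium of the tilted dynamics is a common zero of the a_k and of the
    b_j + sum_k gamma_j^k c_k ([tilted_equilibrium]).  Differentiating these
    equations along gamma |-> Xstar(gamma) at gamma = 0, in the direction of the
    entry (k, j), gives for the velocity X' of Xstar that da_{k'}[X'] = 0 for all
    k', that db_{j'}[X'] = 0 for j' <> j, and that db_j[X'] = - c_k(xstar).

    On the other side, the projected gradients sum to the field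
    sum_k a_k f_{1,k} + sum_j b_j f_{2,j} ([grad_along_span]), whose
    coefficients vanish at xstar.  Hence the Leibniz rule kills all Christoffel
    terms there and A[v] = sum_k da_k[v] f_{1,k} + sum_j db_j[v] f_{2,j}.  The
    same computation applies to every additive operator on vector fields that
    obeys the Leibniz rule at xstar ([derivation_seeking]); besides the connection
    this covers the ordinary derivative of the components in a chart.
    Substituting X' yields A[X'] = - c_k(xstar) f_{2,j}(xstar), and it remains to
    invert A.

    Since the frame is free, A[v] = 0 forces all da_k[v] and db_j[v] to vanish,
    so v also lies in the kernel of the Jacobian, in a chart, of the nominal
    dynamics with gains kappa_i.  That Jacobian is injective because xstar is
    exponentially stable ([exp_stable_derive_inj]): if it were singular, some
    nonzero covector w would annihilate its range, the component of a solution
    along w would move only to second order in the initial displacement, and so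
    it could not decay by a fixed factor in a fixed time. *)

(** * Differentials and iterated derivatives *)

Section Calculus.
Context {R : realType} {V W : normedModType R}.

(** The little-o expansion defining the differential only sees the germ of the
    function. *)
Lemma near_eq_diff (f g : V -> W) (x : V) :
  {near x, f =1 g} -> differentiable f x -> differentiable g x.
Proof.
move=> fg df; have fgx : f x = g x := nbhs_singleton fg.
have gl : g \o shift x = cst (g x) + 'd f x +o_ 0 id.
  apply/eqaddoP => e e0.
  have /eqaddoP /(_ e e0) := diff_locally df.
  have : \forall h \near 0, f (h + x) = g (h + x).
    have shiftx : h + x @[h --> 0] --> x.
      by rewrite -[X in _ --> X]add0r; apply: cvgD; [exact: cvg_id|exact: cvg_cst].
    exact: shiftx fg.
  by apply: filterS2 => h; rewrite !fctE /= => <-; rewrite fgx.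
have dc : continuous ('d f x) := diff_continuous df.
by apply/diff_locallyP; rewrite (diff_unique dc gl).
Qed.

Lemma derive_linear (f : V -> W) (x : V) a u v : differentiable f x ->
  'D_(a *: u + v) f x = a *: 'D_u f x + 'D_v f x.
Proof. by move=> df; rewrite !deriveE// linearP. Qed.

End Calculus.

Lemma derive_comp {R : realType} {U V W : normedModType R}
    (f : U -> V) (g : V -> W) (x v : U) :
  differentiable f x -> differentiable g (f x) ->
  'D_v (g \o f) x = 'D_('D_v f x) g (f x).
Proof.
move=> df dg; rewrite !deriveE//; last exact: differentiable_comp.
by rewrite diff_comp.
Qed.

(** The product rule for vectors is reduced to entries, where it is the product
    rule for real functions. *)
Lemma derive_scale {R : realType} {V : normedModType R} n
    (h : V -> R) (f : V -> 'rV[R]_n) (x v : V) :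
  differentiable h x -> differentiable f x ->
  'D_v (fun y => h y *: f y) x = 'D_v h x *: f x + h x *: 'D_v f x.
Proof.
move=> dh df.
have hv : derivable h x v := diff_derivable dh.
have fv : derivable f x v := diff_derivable df.
have fijv i j : derivable (fun y => f y i j) x v := (derivable_mxP f x v).1 fv i j.
have hf i j : (fun y => (h y *: f y) i j) = h * (fun y => f y i j).
  by apply/funext => y; rewrite mxE.
have hfv : derivable (fun y => h y *: f y) x v.
  by apply/derivable_mxP => i j; rewrite hf; exact: (derivableM hv (fijv i j)).
apply/matrixP => i j; rewrite (derive_mx hfv) mxE hf (deriveM hv (fijv i j)).
rewrite (derive_mx fv) [RHS]mxE addrC; congr (_ + _); rewrite mxE ?mxE//.
exact: mulrC.
Qed.

Lemma derive_entry {R : realType} p q (x w : 'M[R]_(p, q)) i j :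
  'D_w (fun N : 'M[R]_(p, q) => N i j) x = w i j.
Proof.
have did : derivable (id : 'M[R]_(p, q) -> 'M[R]_(p, q)) x w.
  exact: derivable_id.
have := derive_mx did; rewrite (derive_id x w) => wE.
by rewrite [in RHS]wE mxE.
Qed.

Section Smooth.
Context {R : realType} {V : normedModType R}.
Implicit Types D : set V.

(** Differentiability to order n + 1, recursively on the innermost direction.
    The product rule expresses the first derivatives of a product by products
    of the factors and their first derivatives, so induction on n, with a
    common order for both factors, gives closure under products; induction on
    lists of directions would not. *)
Definition diff_upto {W : normedModType R} := fix level n D (f : V -> W) :=
  (forall x, D x -> differentiable f x) /\
  if n is n'.+1 then forall v, level n' D ('D_v f) else True.

Lemma smooth_onP {W : normedModType R} D (f : V -> W) :
  smooth_on D f <-> forall n, diff_upto n D f.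
Proof.
have rconsE s v (h : V -> W) :
    iter_derive (rcons s v) h = iter_derive s ('D_v h).
  by rewrite /iter_derive foldr_rcons.
split=> [sf n|].
  elim: n f sf => [|n IH] f sf /=; first by split=> // x /(sf [::]).
  split=> [x /(sf [::])//|v]; apply: IH => s x Dx.
  by rewrite -rconsE; exact: sf.
move=> df s; elim/last_ind: s f df => [|s v IH] f df x Dx.
  by have [/(_ x Dx)] := df 0%N.
rewrite rconsE; apply: IH => // n.
by have [_ Df] := df n.+1; exact: Df.
Qed.

Lemma diff_upto_diff {W : normedModType R} n D (f : V -> W) x :
  diff_upto n D f -> D x -> differentiable f x.
Proof. by case: n => [|n] [+ _] => /[apply]. Qed.

Lemma diff_uptoW {W : normedModType R} n D (f : V -> W) :
  diff_upto n.+1 D f -> diff_upto n D f.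
Proof.
elim: n f => [|n IH] f [df Df]; split=> // v; apply: IH.
exact: Df.
Qed.

Lemma open_near_eq {W : Type} D (f g : V -> W) x :
  open D -> (forall y, D y -> f y = g y) -> D x -> {near x, f =1 g}.
Proof.
by move=> oD fg Dx; apply: (filterS fg); exact: open_nbhs_nbhs.
Qed.

Lemma eq_diff_upto {W : normedModType R} n D (f g : V -> W) : open D ->
  (forall x, D x -> f x = g x) -> diff_upto n D f -> diff_upto n D g.
Proof.
move=> oD; elim: n f g => [|n IH] f g fg [df Df].
  split=> // x Dx.
  by apply: near_eq_diff (df x Dx); exact: open_near_eq Dx.
split=> [x Dx|v].
  by apply: near_eq_diff (df x Dx); exact: open_near_eq Dx.
apply: (IH ('D_v f)); last exact: Df.
move=> x Dx.
by apply: near_eq_derive; exact: open_near_eq Dx.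
Qed.

Lemma eq_smooth_on {W : normedModType R} D (f g : V -> W) : open D ->
  (forall x, D x -> f x = g x) -> smooth_on D f -> smooth_on D g.
Proof.
by move=> oD fg /smooth_onP sf; apply/smooth_onP => n; exact: eq_diff_upto fg _.
Qed.

Lemma sub_smooth_on {W : normedModType R} D D' (f : V -> W) :
  D `<=` D' -> smooth_on D' f -> smooth_on D f.
Proof. by move=> DD' sf s x /DD'; exact: sf. Qed.

Lemma smooth_on_diff {W : normedModType R} D (f : V -> W) x :
  smooth_on D f -> D x -> differentiable f x.
Proof. by move=> sf; exact: (sf [::]). Qed.

Lemma smooth_on_derive {W : normedModType R} D (f : V -> W) v :
  smooth_on D f -> smooth_on D ('D_v f).
Proof.
move=> /smooth_onP sf; apply/smooth_onP => n.
by have [_ Df] := sf n.+1; exact: Df.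
Qed.

Lemma diff_uptoD {W : normedModType R} n D (f g : V -> W) : open D ->
  diff_upto n D f -> diff_upto n D g -> diff_upto n D (f + g).
Proof.
move=> oD; elim: n f g => [|n IH] f g nf ng;
  (split; first by move=> x Dx; apply: differentiableD;
    [exact: (diff_upto_diff nf)|exact: (diff_upto_diff ng)]); first exact: I.
move=> v; have [[df Df] [dg Dg]] := (nf, ng).
apply: (@eq_diff_upto _ _ _ ('D_v f + 'D_v g) _ oD _ (IH _ _ (Df v) (Dg v))).
by move=> x Dx; rewrite deriveD//; apply: diff_derivable; [exact: df|exact: dg].
Qed.

Lemma diff_uptoM n D (f g : V -> R) : open D ->
  diff_upto n D f -> diff_upto n D g -> diff_upto n D (f * g).
Proof.
move=> oD; elim: n f g => [|n IH] f g nf ng;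
  (split; first by move=> x Dx; apply: differentiableM;
    [exact: (diff_upto_diff nf)|exact: (diff_upto_diff ng)]); first exact: I.
move=> v; have [[df Df] [dg Dg]] := (nf, ng).
have nfD := IH _ _ (diff_uptoW nf) (Dg v).
have ngD := IH _ _ (diff_uptoW ng) (Df v).
apply: (@eq_diff_upto _ _ _ (f * 'D_v g + g * 'D_v f) _ oD _
  (diff_uptoD oD nfD ngD)).
by move=> x Dx; rewrite deriveM//; apply: diff_derivable; [exact: df|exact: dg].
Qed.

Lemma diff_upto_lin {W W' : normedModType R} n D (f : V -> W)
    (L : {linear W -> W'}) : open D -> continuous L ->
  diff_upto n D f -> diff_upto n D (L \o f).
Proof.
move=> oD cL; have dL y : differentiable L y by exact: linear_differentiable.
elim: n f => [|n IH] f nf;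
  (split; first by move=> x Dx; apply: differentiable_comp;
    [exact: (diff_upto_diff nf)|exact: dL]); first exact: I.
move=> v; have [df Df] := nf.
apply: (@eq_diff_upto _ _ _ (L \o 'D_v f) _ oD _ (IH _ (Df v))) => x Dx /=.
by rewrite (derive_comp _ (df x Dx) (dL _)) (deriveE _ (dL _)) diff_lin.
Qed.

Lemma smooth_onD {W : normedModType R} D (f g : V -> W) : open D ->
  smooth_on D f -> smooth_on D g -> smooth_on D (f + g).
Proof.
by move=> oD /smooth_onP sf /smooth_onP sg; apply/smooth_onP => n; exact: diff_uptoD.
Qed.

Lemma smooth_onM D (f g : V -> R) : open D ->
  smooth_on D f -> smooth_on D g -> smooth_on D (f * g).
Proof.
by move=> oD /smooth_onP sf /smooth_onP sg; apply/smooth_onP => n; exact: diff_uptoM.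
Qed.

Lemma smooth_on_lin {W W' : normedModType R} D (f : V -> W)
    (L : {linear W -> W'}) : open D -> continuous L ->
  smooth_on D f -> smooth_on D (L \o f).
Proof.
by move=> oD cL /smooth_onP sf; apply/smooth_onP => n; exact: diff_upto_lin.
Qed.

Lemma smooth_on_cst {W : normedModType R} D (w : W) : smooth_on D (cst w).
Proof.
apply/smooth_onP => n; elim: n w => [|n IH] w; split=> //.
move=> v; suff -> : 'D_v (cst w) = cst 0 :> (V -> W) by [].
by apply/funext => x; rewrite derive_cst.
Qed.

Lemma smooth_on_sum {W : normedModType R} D n (f : 'I_n -> V -> W) : open D ->
  (forall i, smooth_on D (f i)) -> smooth_on D (\sum_(i < n) f i).
Proof.
move=> oD sf; elim/big_ind : _ => //; first exact: smooth_on_cst.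
by move=> *; exact: smooth_onD.
Qed.

Lemma smooth_on_coord p q D (f : V -> 'M[R]_(p, q)) i j : open D ->
  smooth_on D f -> smooth_on D (fun x => f x i j).
Proof.
move=> oD sf.
have lin : linear (fun N : 'M[R]_(p, q) => N i j : R) by move=> a N N'; rewrite !mxE.
pose LM := GRing.isLinear.Build _ _ _ _ _ lin.
pose L : {linear 'M[R]_(p, q) -> R} :=
  HB.pack (fun N : 'M[R]_(p, q) => N i j : R) LM.
exact: (@smooth_on_lin _ _ _ f L oD (@coord_continuous _ _ _ i j)).
Qed.

Lemma smooth_onZl {W : normedModType R} D (h : V -> R) (w : W) : open D ->
  smooth_on D h -> smooth_on D (fun x => h x *: w).
Proof.
move=> oD sh.
have lin : linear ( *:%R ^~ w : R -> _) by move=> u y z; rewrite scalerDl scalerA.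
pose LM := GRing.isLinear.Build _ _ _ _ _ lin.
pose L : {linear _ -> _} := HB.pack ( *:%R ^~ w) LM.
exact: (@smooth_on_lin _ _ _ h L oD (@scalel_continuous _ _ w)).
Qed.

(** Entrywise, a product with a vector field is a product of real functions. *)
Lemma smooth_onZ n D (h : V -> R) (f : V -> 'rV[R]_n) : open D ->
  smooth_on D h -> smooth_on D f -> smooth_on D (fun x => h x *: f x).
Proof.
move=> oD sh sf.
have -> : (fun x => h x *: f x) =
    \sum_(l < n) (fun x => (h x * f x 0 l) *: delta_mx 0 l).
  apply/funext => x; rewrite fct_sumE [in LHS](row_sum_delta (f x)) scaler_sumr.
  by apply: eq_bigr => l _; rewrite scalerA.
apply: smooth_on_sum => // l; apply: smooth_onZl => //.
by apply: smooth_onM => //; exact: smooth_on_coord.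
Qed.

End Smooth.

(** * Calculus in charts *)

(* [inv i] is the inverse of the chart [i], not the inverse of a bijection. *)
Local Notation inv := Defs.inv.

Section Charts.
Context {R : realType} {m : nat} {M : manifold R m}.
Notation T := 'rV[R]_m.
Implicit Types (i j : chart M) (U : set M) (X Y : vector_field M).

(** Near a point, a chart and its inverse can be treated as mutually inverse:
    every local computation below starts by restricting to such points. *)
Lemma phi_image_nbhs i U x : open U -> dom i x -> U x ->
  \forall y \near phi i x,
    [/\ dom i (inv i y), U (inv i y) & phi i (inv i y) = y].
Proof.
move=> oU ix Ux.
have imN : \forall y \near phi i x, (phi i @` dom i) y.
  by apply: open_nbhs_nbhs; split; [exact: open_phi_dom|exists x].
have UN : \forall y \near phi i x, U (inv i y).
  apply: (continuous_inv ix); rewrite phiK//.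
  exact: open_nbhs_nbhs.
by apply: filterS2 imN UN => _ [z iz <-]; rewrite phiK.
Qed.

Lemma open_phi_image i U : open U -> open (phi i @` (dom i `&` U)).
Proof.
move=> oU; rewrite openE => _ [x [ix Ux] <-].
apply: filterS (phi_image_nbhs oU ix Ux) => y [iy Uy yE].
by exists (inv i y).
Qed.

Lemma transition_diff i j x : dom i x -> dom j x ->
  differentiable (phi j \o inv i) (phi i x).
Proof.
move=> ix jx; apply: (smooth_on_diff (@smooth_transition _ _ M i j)).
by exists x.
Qed.

Lemma tangent_coord_linear i x a u v : dom i x ->
  tangent_coord i x (a *: u + v) =
    a *: tangent_coord i x u + tangent_coord i x v.
Proof.
move=> ix; apply: derive_linear; apply: transition_diff => //.
exact: dom_chart_at.
Qed.

Lemma tangent_coord0 i x : dom i x -> tangent_coord i x 0 = 0.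
Proof. by move=> ix; rewrite /tangent_coord derive0. Qed.

Lemma tangent_coordZ i x a v : dom i x ->
  tangent_coord i x (a *: v) = a *: tangent_coord i x v.
Proof.
move=> ix; have := tangent_coord_linear a v 0 ix.
by rewrite tangent_coord0// !addr0.
Qed.

Lemma tangent_coordD i x u v : dom i x ->
  tangent_coord i x (u + v) = tangent_coord i x u + tangent_coord i x v.
Proof.
by move=> ix; have := tangent_coord_linear 1 u v ix; rewrite !scale1r.
Qed.

(** In the preferred chart of x the change of coordinates is the identity near
    x, so components in that chart are the tangent vectors themselves. *)
Lemma tangent_coordE (x : M) v : tangent_coord (chart_at x) x v = v.
Proof.
rewrite /tangent_coord -[RHS](derive_id (phi (chart_at x) x) v).
apply: near_eq_derive.
apply: filterS (phi_image_nbhs openT (dom_chart_at x) I) => y [_ _].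
by [].
Qed.

Lemma smooth_fun_diff U h i x : smooth_fun U h -> dom i x -> U x ->
  differentiable (h \o inv i : T -> R) (phi i x).
Proof. by move=> sh ix Ux; apply: (smooth_on_diff (sh i)); exists x. Qed.

Lemma smooth_field_diff U X i x : smooth_field U X -> dom i x -> U x ->
  differentiable (local_rep i X) (phi i x).
Proof. by move=> sX ix Ux; apply: (smooth_on_diff (sX i)); exists x. Qed.

Lemma diff_fun_linear U h x a u v : smooth_fun U h -> U x ->
  diff_fun h x (a *: u + v) = a * diff_fun h x u + diff_fun h x v.
Proof.
move=> sh Ux; apply: derive_linear; apply: smooth_fun_diff sh _ Ux.
exact: dom_chart_at.
Qed.

Lemma diff_fun_sum U h x n (a : 'I_n -> R) (e : 'I_n -> T) :
  smooth_fun U h -> U x ->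
  diff_fun h x (\sum_(k < n) a k *: e k) = \sum_(k < n) a k * diff_fun h x (e k).
Proof.
move=> sh Ux; elim: n a e => [|n IH] a e.
  by rewrite !big_ord0 /diff_fun derive0.
by rewrite !big_ord_recl (diff_fun_linear _ _ _ sh Ux) IH.
Qed.

(** The chain rule through the transition map: dh(x) may be computed in any
    chart around x, not only in the preferred one, which varies with x. *)
Lemma diff_fun_chart U h i x v : open U -> smooth_fun U h -> U x -> dom i x ->
  diff_fun h x v = 'D_(tangent_coord i x v) (h \o inv i : T -> R) (phi i x).
Proof.
move=> oU sh Ux ix; have jx := dom_chart_at x; set j := chart_at x in jx *.
rewrite /diff_fun -/j.
have -> : 'D_v (h \o inv j) (phi j x) =
          'D_v ((h \o inv i) \o (phi i \o inv j)) (phi j x).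
  apply: near_eq_derive.
  apply: filterS (phi_image_nbhs (@open_dom _ _ M i) jx ix) => y [_ iy _] /=.
  by rewrite phiK.
rewrite derive_comp /= ?phiK//; first exact: transition_diff.
exact: smooth_fun_diff sh _ _.
Qed.

Lemma local_repE i X x : dom i x ->
  local_rep i X (phi i x) = tangent_coord i x (X x).
Proof. by move=> ix; rewrite /local_rep phiK. Qed.

Lemma eq_smooth_fun U (h k : M -> R) : open U ->
  (forall x, U x -> h x = k x) -> smooth_fun U h -> smooth_fun U k.
Proof.
move=> oU hk sh i; apply: eq_smooth_on (sh i); first exact: open_phi_image.
by move=> _ [x [ix Ux] <-] /=; rewrite phiK// hk.
Qed.

Lemma eq_smooth_field U X Y : open U ->
  (forall x, U x -> X x = Y x) -> smooth_field U X -> smooth_field U Y.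
Proof.
move=> oU XY sX i; apply: eq_smooth_on (sX i); first exact: open_phi_image.
by move=> _ [x [ix Ux] <-]; rewrite (local_repE X ix) (local_repE Y ix) XY.
Qed.

Lemma sub_smooth_fun U U' (h : M -> R) :
  U `<=` U' -> smooth_fun U' h -> smooth_fun U h.
Proof.
by move=> UU' sh i; apply: sub_smooth_on (sh i) => _ [x [ix /UU' Ux] <-]; exists x.
Qed.

Lemma sub_smooth_field U U' X :
  U `<=` U' -> smooth_field U' X -> smooth_field U X.
Proof.
by move=> UU' sh i; apply: sub_smooth_on (sh i) => _ [x [ix /UU' Ux] <-]; exists x.
Qed.

Lemma smooth_fieldD U X Y : open U -> smooth_field U X -> smooth_field U Y ->
  smooth_field U (fun x => X x + Y x).
Proof.
move=> oU sX sY i; have oD := @open_phi_image i U oU.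
apply: eq_smooth_on (smooth_onD oD (sX i) (sY i)) => //.
move=> _ [x [ix Ux] <-]; rewrite fctE (local_repE X ix) (local_repE Y ix).
by rewrite (local_repE (fun y => X y + Y y) ix) tangent_coordD.
Qed.

Lemma smooth_fieldZ U h X : open U -> smooth_fun U h -> smooth_field U X ->
  smooth_field U (fun x => h x *: X x).
Proof.
move=> oU sh sX i; have oD := @open_phi_image i U oU.
apply: eq_smooth_on (smooth_onZ oD (sh i) (sX i)) => //.
move=> _ [x [ix Ux] <-] /=; rewrite phiK// (local_repE X ix).
by rewrite (local_repE (fun y => h y *: X y) ix) tangent_coordZ.
Qed.

Lemma smooth_field0 U : open U -> smooth_field U (fun=> 0).
Proof.
move=> oU i; have oD := @open_phi_image i U oU.
apply: eq_smooth_on (smooth_on_cst 0) => //.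
by move=> _ [x [ix Ux] <-]; rewrite local_repE// tangent_coord0.
Qed.

Lemma smooth_field_sum U n (X : 'I_n -> vector_field M) : open U ->
  (forall k, smooth_field U (X k)) ->
  smooth_field U (fun x => \sum_(k < n) X k x).
Proof.
move=> oU; elim: n X => [|n IH] X sX.
  by under eq_fun do rewrite big_ord0; exact: smooth_field0.
under eq_fun do rewrite big_ord_recl.
by apply: smooth_fieldD => //; exact: IH.
Qed.

Lemma derive_row n (f : 'rV[R]_n -> R) x v : differentiable f x ->
  'D_v f x = \sum_(l < n) v 0 l * 'D_(delta_mx 0 l) f x.
Proof.
move=> df; rewrite deriveE// {1}(row_sum_delta v) linear_sum.
by apply: eq_bigr => l _; rewrite linearZ deriveE.
Qed.

(** In a fixed chart L_X h is the sum of the components of X times the partial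
    derivatives of h, hence a combination of smooth functions. *)
Lemma lie_derivative_smooth U X h : open U ->
  smooth_field U X -> smooth_fun U h -> smooth_fun U (lie_derivative X h).
Proof.
move=> oU sX sh i; have oD := @open_phi_image i U oU.
pose f := \sum_(l < m)
  (fun y => local_rep i X y 0 l * 'D_(delta_mx 0 l) (h \o inv i) y).
apply: (@eq_smooth_on _ _ _ _ f) => //.
  move=> _ [x [ix Ux] <-].
  rewrite /f fct_sumE -derive_row; last exact: smooth_fun_diff sh _ _.
  rewrite /= phiK// /lie_derivative (diff_fun_chart _ oU sh Ux ix).
  by rewrite local_repE.
apply: smooth_on_sum => // l; apply: smooth_onM => //.
  exact: smooth_on_coord (sX i).
exact: smooth_on_derive (sh i).
Qed.

End Charts.

(** In the chart around c y this is the chain rule between normed spaces, since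
    [map_derive] is the derivative of c read in that chart. *)
Lemma diff_fun_map {R : realType} {m : nat} {M : manifold R m}
    {V : normedModType R} (U : set M) (D : set V) (c : V -> M) (h : M -> R) (y w : V) :
  open U -> smooth_fun U h -> open D -> smooth_map D c -> D y -> U (c y) ->
  differentiable (h \o c) y /\
  'D_w (h \o c) y = diff_fun h (c y) (map_derive c y w).
Proof.
move=> oU sh oD [cc cs] Dy Ucy; set i := chart_at (c y).
have icy : dom i (c y) := dom_chart_at (c y).
have dc : differentiable (phi i \o c) y by apply: (smooth_on_diff (cs i)).
have dh := smooth_fun_diff sh icy Ucy.
have eq_near : \forall z \near y, ((h \o inv i) \o (phi i \o c)) z = (h \o c) z.
  have : \forall z \near y, dom i (c z).
    by apply: (cc y Dy); apply: open_nbhs_nbhs; split => //; exact: open_dom.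
  by apply: filterS => z iz /=; rewrite phiK.
split; first by apply: near_eq_diff eq_near _; exact: differentiable_comp.
by rewrite -(near_eq_derive _ eq_near) derive_comp.
Qed.

(** * Exponential stability makes the Jacobian injective *)

(** A singular endomorphism is not onto, so a covector annihilates its range:
    any nonzero column of the cokernel matrix. *)
Lemma singular_covector {F : fieldType} n (L : {linear 'rV[F]_n -> 'rV[F]_n}) v :
  L v = 0 -> v != 0 ->
  exists (w : 'cV[F]_n) (u : 'rV[F]_n),
    (u *m w) 0 0 = 1 /\ forall y, L y *m w = 0.
Proof.
move=> Lv0 v0; pose J := lin1_mx L.
have : cokermx J != 0.
  apply: contra v0; rewrite -mxrank_eq0 mxrank_coker subn_eq0 => nJ.
  have freeJ : row_free J by rewrite /row_free eqn_leq rank_leq_row.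
  have vJ : v *m J = 0 by rewrite mul_rV_lin1.
  by apply/eqP/(row_free_inj freeJ); rewrite vJ mul0mx.
move: (cokermx J) (mulmx_coker J) => K JK0 K0.
have [i [j Kij]] : exists i j, K i j != 0.
  apply: contrapT => nK; case/eqP: K0; apply/matrixP => i j; rewrite mxE.
  by apply/eqP; apply: contrapT => /negP Kij; apply: nK; exists i, j.
exists (col j K), ((K i j)^-1 *: delta_mx 0 i); split.
  by rewrite -scalemxAl -rowE !mxE mulVf.
by move=> y; rewrite -mul_rV_lin1 -mulmxA colE (mulmxA J) JK0 mul0mx mulmx0.
Qed.

Section Stability.
Context {R : realType}.

Lemma linear_rV_differentiable n (W : normedModType R)
    (L : {linear 'rV[R]_n -> W}) x : differentiable L x.
Proof.
have -> : (L : 'rV[R]_n -> W) =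
    \sum_(l < n) (fun y : 'rV[R]_n => y 0 l *: L (delta_mx 0 l)).
  apply/funext => y; rewrite fct_sumE {1}(row_sum_delta y) linear_sum.
  by apply: eq_bigr => l _; rewrite linearZ.
by apply: differentiable_sum => l; apply: differentiableZl; exact: differentiable_coord.
Qed.

(** Suppose that L, the differential of G at y0, is singular, and let w be a
    covector with w L = 0 and u a vector with w u = 1.  Along the solution c
    from y0 + e u, the derivative of w(c) is w(G(c)), where the linear part of G
    drops out, so it is o(|c - y0|) and hence an arbitrarily small multiple of e
    for small e.  Up to a fixed time t1, w(c - y0) therefore stays within e / 2
    of its initial value e.  But the decay estimate makes |w(c(t1) - y0)| less
    than e / 2 if t1 was chosen large. *)
Lemma exp_decay_derive_inj n (G : 'rV[R]_n -> 'rV[R]_n) (y0 : 'rV[R]_n)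
    (C lambda : R) :
  differentiable G y0 -> G y0 = 0 -> 0 < C -> 0 < lambda ->
  (\forall y \near y0, exists c : R -> 'rV[R]_n,
    [/\ c 0 = y, {within `[0, +oo[, continuous c},
        forall t : R, 0 < t -> is_derive t 1 c (G (c t)) &
        forall t : R, 0 <= t ->
          `|c t - y0| <= C * expR (- lambda * t) * `|y - y0|]) ->
  forall v, 'D_v G y0 = 0 -> v = 0.
Proof.
move=> dG G0 C0 lam0 Gsol v; rewrite deriveE// => Lv0.
apply/eqP; apply: contrapT => /negP v0.
have [w0 [u [wu wL0]]] := singular_covector Lv0 v0.
have wlin : linear (fun y : 'rV[R]_n => (y *m w0) 0 0 : R).
  by move=> a y z; rewrite mulmxDl -scalemxAl !mxE.
pose wM := GRing.isLinear.Build _ _ _ _ _ wlin.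
pose w : {linear 'rV[R]_n -> R} :=
  HB.pack (fun y : 'rV[R]_n => (y *m w0) 0 0 : R) wM.
have wE y : w y = (y *m w0) 0 0 by [].
have wL y : w ('d G y0 y) = 0 by rewrite wE wL0 mxE.
rewrite -wE in wu; clearbody w.
have dw y : differentiable w y := linear_rV_differentiable w y.
have wc : continuous w by move=> y; exact: differentiable_continuous.
have [K K0 wK] := linear_lipschitz wc.
have u0 : 0 < `|u|.
  by rewrite normr_gt0; apply/eqP => u0; move: wu; rewrite u0 linear0 => /eqP;
     rewrite eq_sym oner_eq0.
(* B e bounds K |c - y0| along the solution from y0 + e u, without the
   exponential factor; t1 makes B exp(- lambda t1) < 1/2 by exp x >= 1 + x, and
   eta is chosen so that t1 (eta B e) = e / 2. *)
pose B : R := K * C * `|u|.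
have B0 : 0 < B by rewrite mulr_gt0// mulr_gt0.
pose t1 : R := 2 * B / lambda.
have t10 : 0 < t1 by rewrite divr_gt0// mulr_gt0.
have Bt1 : B * expR (- lambda * t1) < 1 / 2.
  have -> : - lambda * t1 = - (2 * B) by rewrite /t1; field; rewrite gt_eqF.
  rewrite expRN ltr_pdivrMr ?expR_gt0//.
  have := expR_ge1Dx (2 * B); lra.
pose eta : R := 1 / (2 * t1 * B).
have eta0 : 0 < eta by rewrite divr_gt0// mulr_gt0// mulr_gt0.
have Glin : \forall h \near (0 : 'rV[R]_n), `|w (G (h + y0))| <= K * (eta * `|h|).
  have /eqaddoP /(_ eta eta0) := diff_locally dG.
  apply: filterS => h; rewrite !fctE /= G0 add0r => Gh.
  rewrite -[w _]subr0 -(wL h) -linearB.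
  by apply: le_trans (wK _) _; rewrite ler_pM2l.
have [delta /= delta0 Gd] : exists2 d : R, 0 < d &
    forall h : 'rV[R]_n, `|h| < d -> `|w (G (h + y0))| <= K * (eta * `|h|).
  move/nbhs_ballP : Glin => [d /= d0 Bd]; exists d => // h hd; apply: Bd.
  by rewrite -ball_normE /= sub0r normrN.
have [r /= r0 Vr] : exists2 r : R, 0 < r &
   forall h : 'rV[R]_n, `|h| < r -> exists c : R -> 'rV[R]_n,
    [/\ c 0 = h + y0, {within `[0, +oo[, continuous c},
        forall t : R, 0 < t -> is_derive t 1 c (G (c t)) &
        forall t : R, 0 <= t ->
          `|c t - y0| <= C * expR (- lambda * t) * `|h|].
  move/nbhs_ballP : Gsol => [d /= d0 Bd]; exists d => // h hd.
  have [|c] := Bd (h + y0).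
    by rewrite -ball_normE /= distrC addrK.
  by rewrite addrK; exists c.
(* The first bound keeps the initial point where solutions are controlled, the
   second keeps the solution where the linearization is accurate. *)
pose e : R := Num.min (r / (2 * `|u|)) (delta / (2 * C * `|u|)).
have e0 : 0 < e by rewrite lt_min !divr_gt0// !mulr_gt0.
have er : e * `|u| < r.
  apply: (@le_lt_trans _ _ (r / 2)); last by lra.
  rewrite -ler_pdivlMr// /e ge_min; apply/orP; left.
  by rewrite invfM mulrA.
have ed : C * (e * `|u|) < delta.
  apply: (@le_lt_trans _ _ (delta / 2)); last by lra.
  rewrite mulrCA -ler_pdivlMr ?mulr_gt0// /e ge_min; apply/orP; right.
  by rewrite -(mulrA 2) invfM mulrA.
have neu : `|e *: u| = e * `|u| by rewrite normrZ gtr0_norm.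
have [|c [c0 cc dc cdec]] := Vr (e *: u); first by rewrite neu.
have cbound t : 0 <= t -> `|c t - y0| <= C * (e * `|u|).
  move=> t0; apply: le_trans (cdec t t0) _; rewrite neu.
  rewrite -mulrA ler_pM2l//; apply: ler_piMl; first by rewrite mulr_ge0// ltW.
  by rewrite -[leRHS]expR0 ler_expR mulNr oppr_le0 mulr_ge0// ltW.
have [||s] := @MVT_segment R (w \o c) (fun t => w (G (c t))) 0 t1 (ltW t10).
- move=> t; rewrite in_itv /= => /andP[t0 _].
  have [ct <-] := dc t t0.
  have dct : differentiable c t by exact/derivable1_diffP.
  apply: DeriveDef; first by apply/diff_derivable/differentiable_comp.
  rewrite derive_comp// (deriveE _ (dw _)) diff_lin//.
- have cc1 : {within `[0, t1], continuous c}.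
    by apply: continuous_subspaceW cc => t /=; rewrite !in_itv /= => /andP[->].
  by move=> t; apply: (@continuous_comp (subspace `[0, t1]) _ _ c w); [exact: cc1|exact: wc].
rewrite in_itv /= => /andP[s0 st1]; rewrite subr0 c0 => mvt.
have ws : `|w (G (c s)) * t1| <= e / 2.
  rewrite normrM (gtr0_norm t10) -ler_pdivlMr//.
  rewrite -[c s](subrK y0).
  apply: le_trans (Gd _ _) _; first exact: le_lt_trans (cbound _ s0) ed.
  apply: (@le_trans _ _ (K * (eta * (C * (e * `|u|))))).
    by rewrite ler_pM2l// ler_pM2l// cbound.
  rewrite le_eqVlt; apply/orP; left; apply/eqP; rewrite /eta /B.
  by field; rewrite !gt_eqF.
have wt : `|w (c t1 - y0)| < e / 2.
  apply: le_lt_trans (wK _) _.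
  apply: (@le_lt_trans _ _ (e * (B * expR (- lambda * t1)))).
    apply: (@le_trans _ _ (K * (C * expR (- lambda * t1) * `|e *: u|))).
      by rewrite ler_pM2l//; apply: cdec; exact: ltW.
    by rewrite neu /B le_eqVlt; apply/orP; left; apply/eqP; ring.
  by rewrite ltr_pM2l//; lra.
have : w (c t1 - y0) - w (G (c s)) * t1 = e.
  have we : w (e *: u) = e by rewrite linearZ wu; exact: mulr1.
  by rewrite -mvt /= (linearB w) (linearD w) we; ring.
move: ws wt; move: (w (c t1 - y0)) (w (G (c s)) * t1) => p q.
rewrite ler_norml ltr_norml => /andP[h1 h2] /andP[h3 h4] h5.
clear -h1 h2 h3 h4 h5; lra.
Qed.

End Stability.

Section ManifoldStability.
Context {R : realType} {m : nat} {M : manifold R m}.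

(** A solution on the manifold becomes, in the chart around x, a solution of
    the field in coordinates; at each time the derivative is transported from
    the preferred chart of the current point, and this transport is the one
    built into [local_rep]. *)
Lemma exp_stable_derive_inj (F : vector_field M) (x : M) :
  let i := chart_at x in
  locally_exp_stable F x -> differentiable (local_rep i F) (phi i x) ->
  forall v, 'D_v (local_rep i F) (phi i x) = 0 -> v = 0.
Proof.
move=> i [F0 [V [C [lambda [xV C0 l0 sol]]]]] dF.
have ix : dom i x := dom_chart_at x.
apply: exp_decay_derive_inj dF _ C0 l0 _.
  by rewrite local_repE// tangent_coordE.
have VN : \forall y \near phi i x, V (inv i y).
  by apply: (continuous_inv ix); rewrite phiK.
apply: filterS2 VN (phi_image_nbhs openT ix I) => y Vy [iy _ yE].
have [[c [Fc c0]] stab] := sol _ Vy.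
have {}stab t (t0 : 0 <= t) := stab c Fc c0 t t0.
have [cc dc] := Fc.
exists (phi i \o c); split.
- by rewrite /= c0.
- apply/subspace_continuousP => t /=; rewrite in_itv /= andbT => t0.
  have ct : c s @[s --> within `[0, +oo[ (nbhs t)] --> c t.
    by move/subspace_continuousP : cc; apply; rewrite /= in_itv /= t0.
  apply: (cvg_comp _ _ ct).
  by apply: continuous_phi; have [] := stab t t0.
- move=> t t0; have [it _] := stab t (ltW t0).
  have ct : {for t, continuous c}.
    have : {within `]0, +oo[, continuous c}.
      apply: continuous_subspaceW cc => s /=; rewrite !in_itv /= !andbT.
      exact: ltW.
    by rewrite continuous_open_subspace//; apply; rewrite inE /= in_itv /= t0.
  set j := chart_at (c t); have jt : dom j (c t) := dom_chart_at (c t).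
  have := dc t t0; rewrite -/j => dj.
  have [djt djE] := dj.
  have {}djt : differentiable (phi j \o c) t by exact/derivable1_diffP.
  apply: (@near_eq_is_derive _ _ _ ((phi i \o inv j) \o (phi j \o c))).
    have : \forall s \near t, dom j (c s).
      by apply: ct; apply: open_nbhs_nbhs; split => //; exact: open_dom.
    by apply: filterS => s js /=; rewrite phiK.
  have dij := transition_diff jt it.
  apply: DeriveDef; first by apply/diff_derivable/differentiable_comp.
  by rewrite (derive_comp _ djt dij) djE (local_repE F it).
- by move=> t t0; have [_] := stab t t0; rewrite -/i yE.
Qed.

End ManifoldStability.

(** * Gradients and projections in an orthonormal frame *)

Section Metric.
Context {R : realType} {m : nat} {M : manifold R m}.
Variables (U : set M) (g : metric_tensor M).
Hypothesis gU : riemannian_metric U g.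
Notation T := 'rV[R]_m.
Implicit Types (x : M) (u v w : T).

Lemma metric_sym x v w : U x -> g x v w = g x w v.
Proof. by have [_ gs _ _] := gU => Ux; exact: gs. Qed.

Lemma metric_linear x a u v w : U x ->
  g x (a *: u + v) w = a * g x u w + g x v w.
Proof. by have [gl _ _ _] := gU => Ux; exact: gl. Qed.

Lemma metric0 x w : U x -> g x 0 w = 0.
Proof.
move=> Ux; have := metric_linear (-1) 0 0 w Ux.
by rewrite scaler0 addr0 mulN1r addNr.
Qed.

Lemma metricD x u v w : U x -> g x (u + v) w = g x u w + g x v w.
Proof. by move=> Ux; rewrite -[u]scale1r metric_linear// scale1r mul1r. Qed.

Lemma metricB x u v w : U x -> g x (u - v) w = g x u w - g x v w.
Proof. by move=> Ux; rewrite addrC -scaleN1r metric_linear// mulN1r addrC. Qed.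

Lemma metric_sum x n (a : 'I_n -> R) (e : 'I_n -> T) w : U x ->
  g x (\sum_(k < n) a k *: e k) w = \sum_(k < n) a k * g x (e k) w.
Proof.
move=> Ux; elim: n a e => [|n IH] a e; first by rewrite !big_ord0 metric0.
by rewrite !big_ord_recl metric_linear// IH.
Qed.

Lemma metric_inj x v : U x -> g x v v = 0 -> v = 0.
Proof.
move=> Ux gv0; apply/eqP; apply: contrapT => /negP v0.
by have [_ _ /(_ x Ux v v0)] := gU; rewrite gv0 ltxx.
Qed.

End Metric.

Lemma span_fieldsP {R : realType} {m : nat} {M : manifold R m} d
    (f : 'I_d -> vector_field M) x v :
  reflect (exists a, v = \sum_(k < d) a k *: f k x) (v \in span_fields f x).
Proof.
apply: (iffP idP); rewrite /span_fields span_def big_image /=.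
  move=> /memv_sumP[vs vsP ->].
  have /choice[a aP] : forall k, exists a, vs k = a *: f k x.
    by move=> k; have /vlineP := vsP k isT.
  by exists a; apply: eq_bigr => k _.
move=> [a ->]; apply: memv_sumr => k _.
by rewrite memvZ// memv_line.
Qed.

Section Frame.
Context {R : realType} {m : nat} {M : manifold R m} {d1 d2 : nat}.
Variables (U : set M) (g : metric_tensor M).
Variables (f1 : 'I_d1 -> vector_field M) (f2 : 'I_d2 -> vector_field M).
Hypothesis gU : riemannian_metric U g.
Hypothesis on : orthonormal_frame U g f1 f2.
Notation T := 'rV[R]_m.

Lemma metric_orthonormal_sum x d (f : 'I_d -> vector_field M) (a : 'I_d -> R) k :
  U x -> (forall j k, g x (f j x) (f k x) = (j == k)%:R) ->
  g x (\sum_(j < d) a j *: f j x) (f k x) = a k.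
Proof.
move=> Ux onf; rewrite (metric_sum gU)// (bigD1 k)//= onf eqxx mulr1.
rewrite big1 ?addr0// => j jk; rewrite onf.
by rewrite (negbTE jk) mulr0.
Qed.

Lemma metric_frame x (a : 'I_d1 -> R) (b : 'I_d2 -> R) : U x ->
  let v := \sum_(k < d1) a k *: f1 k x + \sum_(j < d2) b j *: f2 j x in
  (forall k, g x v (f1 k x) = a k) /\ (forall j, g x v (f2 j x) = b j).
Proof.
move=> Ux v; have [on1 on2 on12] := on Ux; split=> k; rewrite (metricD gU)//.
  rewrite metric_orthonormal_sum// (metric_sum gU)// big1 ?addr0// => j _.
  by rewrite (metric_sym gU)// on12 mulr0.
rewrite (metric_orthonormal_sum _ _ Ux on2) (metric_sum gU)// big1 ?add0r//.
by move=> j _; rewrite on12 mulr0.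
Qed.

(** Orthonormality recovers the coefficients as inner products. *)
Lemma frame_free x (a : 'I_d1 -> R) (b : 'I_d2 -> R) : U x ->
  \sum_(k < d1) a k *: f1 k x + \sum_(j < d2) b j *: f2 j x = 0 ->
  (forall k, a k = 0) /\ forall j, b j = 0.
Proof.
move=> Ux ab0; have [ga gb] := metric_frame a b Ux.
by split=> k; [rewrite -ga|rewrite -gb]; rewrite ab0 (metric0 gU).
Qed.

Hypothesis full : forall x, U x ->
  (span_fields f1 x + span_fields f2 x)%VS = fullv.

(** The full span of the frame is what makes the gradient exist: the candidate
    with coefficients dh[f] represents dh on the frame, hence on all vectors.
    Without a solution, [grad] would return its default value. *)
Lemma gradP (h : M -> R) x v : smooth_fun U h -> U x ->
  g x (grad g h x) v = diff_fun h x v.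
Proof.
move=> sh Ux.
have dl := diff_fun_linear _ _ _ sh Ux.
have dsum := diff_fun_sum _ _ sh Ux.
suff : [set w | forall v, g x w v = diff_fun h x v] !=set0.
  by move=> /(@xgetPex _ 0); apply.
exists (\sum_(k < d1) diff_fun h x (f1 k x) *: f1 k x +
        \sum_(j < d2) diff_fun h x (f2 j x) *: f2 j x) => u /=.
have : u \in (span_fields f1 x + span_fields f2 x)%VS by rewrite full// memvf.
move=> /memv_addP[u1 /span_fieldsP[a ->] [u2 /span_fieldsP[b ->] ->]].
have [ga gb] := metric_frame (fun k => diff_fun h x (f1 k x))
  (fun j => diff_fun h x (f2 j x)) Ux.
rewrite (metric_sym gU)// (metricD gU)// !(metric_sum gU)//.
rewrite -[in RHS](scale1r (\sum_(k < d1) _)) dl mul1r !dsum.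
by congr (_ + _); apply: eq_bigr => k _; rewrite (metric_sym gU)// (ga, gb).
Qed.

(** The combination is a valid projection, and two valid projections differ by
    a vector of the span orthogonal to the span, which is zero. *)
Lemma orth_proj_span x d (f : 'I_d -> vector_field M) v : U x ->
  (forall j k, g x (f j x) (f k x) = (j == k)%:R) ->
  orth_proj g (span_fields f) x v = \sum_(k < d) g x v (f k x) *: f k x.
Proof.
move=> Ux onf; set p := \sum_(k < d) _.
have fperp w : (forall k, g x w (f k x) = 0) ->
    forall u, u \in span_fields f x -> g x w u = 0.
  move=> wf u /span_fieldsP[a ->]; rewrite (metric_sym gU)// (metric_sum gU)//.
  by rewrite big1// => k _; rewrite (metric_sym gU)// wf mulr0.
have pP : p \in span_fields f x.
  by apply/span_fieldsP; exists (fun k => g x v (f k x)).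
have pperp u : u \in span_fields f x -> g x (v - p) u = 0.
  apply: fperp => k; rewrite (metricB gU)//.
  by rewrite metric_orthonormal_sum// subrr.
rewrite /orth_proj; case: xgetP => [w _ [wE wperp]|none]; last first.
  by case: (none p).
apply/subr0_eq/(metric_inj gU Ux).
have wpE : w - p \in span_fields f x by rewrite memvB.
by have := pperp _ wpE; rewrite -(subrKA w) (metricD gU)// wperp// add0r.
Qed.

Lemma grad_along_span x d (f : 'I_d -> vector_field M) (h : M -> R) :
  smooth_fun U h -> U x -> (forall j k, g x (f j x) (f k x) = (j == k)%:R) ->
  grad_along g (span_fields f) h x =
    \sum_(k < d) lie_derivative (f k) h x *: f k x.
Proof.
move=> sh Ux onf; rewrite /grad_along orth_proj_span//.
by apply: eq_bigr => k _; rewrite gradP.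
Qed.

End Frame.

(** * Derivations of vector fields at a point *)

Section Derivation.
Context {R : realType} {m : nat} {M : manifold R m}.
Variables (U : set M) (x : M) (v : 'rV[R]_m).
Hypotheses (oU : open U) (Ux : U x).

(** What covariant differentiation at x in the direction v and differentiation
    of the components in a chart have in common.  On a combination of smooth
    fields whose coefficients vanish at x these two rules already determine the
    value, so that there both operators agree. *)
Definition derivation_at (D : vector_field M -> 'rV[R]_m) : Prop :=
  (forall Y Z, smooth_field U Y -> smooth_field U Z ->
     D (fun y => Y y + Z y) = D Y + D Z) /\
  (forall h Y, smooth_fun U h -> smooth_field U Y ->
     D (fun y => h y *: Y y) = diff_fun h x v *: Y x + h x *: D Y).

Lemma diff_fun_cst (a : R) : diff_fun (fun=> a : R) x v = 0.
Proof. exact: derive_cst. Qed.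

Lemma smooth_fun_cst (a : R) : smooth_fun U (fun=> a).
Proof. by move=> i; exact: smooth_on_cst. Qed.

Lemma eq_diff_fun (h k : M -> R) : (forall y, U y -> h y = k y) ->
  diff_fun h x v = diff_fun k x v.
Proof.
move=> hk; apply: near_eq_derive.
apply: filterS (phi_image_nbhs oU (dom_chart_at x) Ux) => y [_ Uy _] /=.
exact: hk.
Qed.

Lemma nabla_derivation (nabla : connection M) :
  affine_connection U nabla -> derivation_at (fun Y => nabla Y x v).
Proof.
by move=> [_ nD nM _]; split=> [Y Z|h Y] *; [exact: nD|exact: nM].
Qed.

(** Taking components at a point is linear, so it commutes with sums and with
    multiplication by functions; the rest is the product rule in the chart. *)
Lemma local_rep_derivation :
  derivation_at (fun Y => 'D_v (local_rep (chart_at x) Y) (phi (chart_at x) x)).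
Proof.
set i := chart_at x; have ix : dom i x := dom_chart_at x.
have near_U := phi_image_nbhs oU ix Ux.
split=> [Y Z sY sZ|h Y sh sY].
  have dY := smooth_field_diff sY ix Ux; have dZ := smooth_field_diff sZ ix Ux.
  rewrite -(deriveD (diff_derivable dY) (diff_derivable dZ)).
  apply: near_eq_derive; apply: filterS near_U => y [iy _ _].
  exact: tangent_coordD.
have dh := smooth_fun_diff sh ix Ux; have dY := smooth_field_diff sY ix Ux.
have -> : 'D_v (local_rep i (fun y => h y *: Y y)) (phi i x) =
    'D_v (fun y => (h \o inv i) y *: local_rep i Y y) (phi i x).
  apply: near_eq_derive; apply: filterS near_U => y [iy _ _].
  by rewrite /local_rep tangent_coordZ.
rewrite derive_scale//.
by rewrite /= phiK// local_repE// tangent_coordE.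
Qed.

Variable D : vector_field M -> 'rV[R]_m.
Hypothesis derD : derivation_at D.

(** Multiplying by the indicator function of U, which is smooth on U with zero
    differential there, changes neither side and makes the two fields equal
    everywhere. *)
Lemma eq_derivation (Y Z : vector_field M) : smooth_field U Y ->
  (forall y, U y -> Y y = Z y) -> D Y = D Z.
Proof.
move=> sY YZ; have sZ := eq_smooth_field oU YZ sY; have [_ DM] := derD.
have sone : smooth_fun U (\1_U : M -> R).
  apply: eq_smooth_fun oU _ (smooth_fun_cst 1) => y Uy.
  by rewrite indicE mem_set.
have dsone : diff_fun (\1_U : M -> R) x v = 0.
  rewrite -(diff_fun_cst 1); apply: eq_diff_fun => y Uy.
  by rewrite indicE mem_set.
have cut W : smooth_field U W -> D (fun y => \1_U y *: W y) = D W.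
  by move=> sW; rewrite DM// dsone scale0r add0r indicE mem_set// scale1r.
rewrite -(cut Y)// -(cut Z)//; congr D; apply/funext => y.
rewrite indicE; case: (boolP (y \in U)) => [/set_mem Uy|_]; last by rewrite !scale0r.
by rewrite YZ.
Qed.

(** The Leibniz rule produces the unknown values D (X k) only with the
    coefficients a k x, which are zero. *)
Lemma derivation_vanishing_sum d (a : 'I_d -> M -> R) (X : 'I_d -> vector_field M) :
  (forall k, smooth_fun U (a k)) -> (forall k, smooth_field U (X k)) ->
  (forall k, a k x = 0) ->
  D (fun y => \sum_(k < d) a k y *: X k y) =
    \sum_(k < d) diff_fun (a k) x v *: X k x.
Proof.
have [DD DM] := derD.
elim: d a X => [|d IH] a X sa sX a0.
  under eq_fun do rewrite big_ord0.
  have s0 := @smooth_field0 _ _ M U oU.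
  rewrite big_ord0; have := DD _ _ s0 s0; under eq_fun do rewrite addr0.
  by move/(congr1 (fun w => w - D (fun=> 0))); rewrite addrK subrr.
under eq_fun do rewrite big_ord_recl.
rewrite big_ord_recl DD.
- by rewrite DM// a0 scale0r addr0 IH.
- exact: smooth_fieldZ.
- by apply: smooth_field_sum => // k; exact: smooth_fieldZ.
Qed.

End Derivation.

Lemma linear_inj_inverse {F : fieldType} n (A : 'rV[F]_n -> 'rV[F]_n) :
  (forall a u v, A (a *: u + v) = a *: A u + A v) ->
  (forall v, A v = 0 -> v = 0) ->
  exists Ainv : 'rV[F]_n -> 'rV[F]_n, [/\ cancel A Ainv, cancel Ainv A &
    forall a u, Ainv (a *: u) = a *: Ainv u].
Proof.
move=> linA injA; pose LM := GRing.isLinear.Build _ _ _ _ A linA.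
pose L : {linear 'rV[F]_n -> 'rV[F]_n} := HB.pack A LM.
have AE v : A v = v *m lin1_mx L by rewrite mul_rV_lin1.
have unitJ : lin1_mx L \in unitmx.
  rewrite -row_free_unit; apply: inj_row_free => v; rewrite -AE; exact: injA.
exists (fun v => v *m invmx (lin1_mx L)); split=> [v|v|a u].
- by rewrite AE mulmxK.
- by rewrite AE mulmxKV.
- by rewrite scalemxAl.
Qed.

(** * Equilibria and linearization of the seeking dynamics *)

Section SeekingDynamics.
Context {R : realType} {m : nat} {M : manifold R m} {d1 d2 : nat}.
Variables (U : set M) (g : metric_tensor M).
Variables (f1 : 'I_d1 -> vector_field M) (f2 : 'I_d2 -> vector_field M).
Variables J1 J2 : M -> R.
Hypothesis oU : open U.
Hypothesis gU : riemannian_metric U g.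
Hypothesis on : orthonormal_frame U g f1 f2.
Hypotheses (sJ1 : smooth_fun U J1) (sJ2 : smooth_fun U J2).
Hypotheses (sf1 : forall k, smooth_field U (f1 k)).
Hypotheses (sf2 : forall j, smooth_field U (f2 j)).

Lemma lie_derivative_tilt gamma j x : U x ->
  lie_derivative (tilt gamma f1 f2 j) J2 x =
    lie_derivative (f2 j) J2 x +
    \sum_(k < d1) gamma k j * lie_derivative (f1 k) J2 x.
Proof.
move=> Ux; rewrite /lie_derivative /tilt -[f2 j x]scale1r.
rewrite (diff_fun_linear _ _ _ sJ2 Ux) mul1r scale1r; congr (_ + _).
exact: (diff_fun_sum _ _ sJ2).
Qed.

(** Expanded in the original frame, the tilted field has coefficient
    kappa2 L_{tilt j} J2 on f2 j, so these vanish first; the corrections that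
    the tilt adds to the coefficients of f1 k then vanish too. *)
Lemma tilted_equilibrium kappa1 kappa2 gamma x :
  0 < kappa1 -> 0 < kappa2 -> U x ->
  seeking_dynamics kappa1 kappa2 J1 J2 f1 (tilt gamma f1 f2) x = 0 ->
  (forall k, lie_derivative (f1 k) J1 x = 0) /\
  (forall j, lie_derivative (f2 j) J2 x +
     \sum_(k < d1) gamma k j * lie_derivative (f1 k) J2 x = 0).
Proof.
move=> k10 k20 Ux; rewrite /seeking_dynamics.
pose beta j := kappa2 * lie_derivative (tilt gamma f1 f2 j) J2 x.
pose alpha k := kappa1 * lie_derivative (f1 k) J1 x.
have -> : kappa1 *: (\sum_(k < d1) lie_derivative (f1 k) J1 x *: f1 k x) =
    \sum_(k < d1) alpha k *: f1 k x.
  by rewrite scaler_sumr; apply: eq_bigr => k _; rewrite scalerA.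
have -> : kappa2 *: (\sum_(j < d2)
      lie_derivative (tilt gamma f1 f2 j) J2 x *: tilt gamma f1 f2 j x) =
    \sum_(k < d1) (\sum_(j < d2) beta j * gamma k j) *: f1 k x +
    \sum_(j < d2) beta j *: f2 j x.
  under [X in _ = X + _]eq_bigr do rewrite scaler_suml.
  rewrite exchange_big -big_split scaler_sumr; apply: eq_bigr => j _ /=.
  rewrite scalerA -/(beta j) /tilt scalerDr addrC scaler_sumr; congr (_ + _).
  by apply: eq_bigr => k _; rewrite scalerA.
rewrite addrA -big_split /=; under eq_bigr do rewrite -scalerDl.
move=> /(frame_free gU on Ux)[ab0 b0].
have a0 k : alpha k = 0.
  by have := ab0 k; rewrite big1 ?addr0// => j _; rewrite b0 mul0r.
split=> [k|j].
  by have /eqP := a0 k; rewrite mulf_eq0 gt_eqF//= => /eqP.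
rewrite -lie_derivative_tilt//.
by have /eqP := b0 j; rewrite mulf_eq0 gt_eqF//= => /eqP.
Qed.

Lemma seeking_smooth kappa1 kappa2 :
  smooth_field U (seeking_dynamics kappa1 kappa2 J1 J2 f1 f2).
Proof.
have sS d (h : M -> R) (f : 'I_d -> vector_field M) kappa :
    smooth_fun U h -> (forall k, smooth_field U (f k)) ->
    smooth_field U (fun y => kappa *: \sum_(k < d) lie_derivative (f k) h y *: f k y).
  move=> sh sf; apply: smooth_fieldZ => //; first exact: smooth_fun_cst.
  exact: (smooth_field_sum oU
    (fun k => smooth_fieldZ oU (lie_derivative_smooth oU (sf k) sh) (sf k))).
by apply: smooth_fieldD => //; exact: sS.
Qed.

Lemma derivation_seeking kappa1 kappa2 x v (D : vector_field M -> 'rV[R]_m) :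
  U x -> derivation_at U x v D ->
  (forall k, lie_derivative (f1 k) J1 x = 0) ->
  (forall j, lie_derivative (f2 j) J2 x = 0) ->
  D (seeking_dynamics kappa1 kappa2 J1 J2 f1 f2) =
    kappa1 *: (\sum_(k < d1) diff_fun (lie_derivative (f1 k) J1) x v *: f1 k x) +
    kappa2 *: (\sum_(j < d2) diff_fun (lie_derivative (f2 j) J2) x v *: f2 j x).
Proof.
move=> Ux derD a0 b0; have [DD DM] := derD.
have sa k : smooth_fun U (lie_derivative (f1 k) J1) by exact: lie_derivative_smooth.
have sb j : smooth_fun U (lie_derivative (f2 j) J2) by exact: lie_derivative_smooth.
have sc (kappa : R) : smooth_fun U (fun=> kappa) by exact: smooth_fun_cst.
have sG1 : smooth_field U (fun y => \sum_(k < d1) lie_derivative (f1 k) J1 y *: f1 k y).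
  exact: (smooth_field_sum oU (fun k => smooth_fieldZ oU (sa k) (sf1 k))).
have sG2 : smooth_field U (fun y => \sum_(j < d2) lie_derivative (f2 j) J2 y *: f2 j y).
  exact: (smooth_field_sum oU (fun j => smooth_fieldZ oU (sb j) (sf2 j))).
rewrite (DD _ _ (smooth_fieldZ oU (sc kappa1) sG1) (smooth_fieldZ oU (sc kappa2) sG2)).
rewrite (DM _ _ (sc kappa1) sG1) (DM _ _ (sc kappa2) sG2).
rewrite !diff_fun_cst !scale0r !add0r.
by rewrite !(derivation_vanishing_sum oU derD).
Qed.

(** The field differentiated in the intrinsic Jacobian is the nominal dynamics
    with unit gains. *)
Lemma grad_sum_seeking x : U x ->
  (forall x, U x -> (span_fields f1 x + span_fields f2 x)%VS = fullv) ->
  grad_along g (span_fields f1) J1 x + grad_along g (span_fields f2) J2 x =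
    seeking_dynamics 1 1 J1 J2 f1 f2 x.
Proof.
move=> Ux full; have [on1 on2 _] := on Ux.
rewrite (grad_along_span gU on full sJ1)// (grad_along_span gU on full sJ2)//.
by rewrite /seeking_dynamics !scale1r.
Qed.

End SeekingDynamics.

Theorem corollary4 (R : realType) (m : nat) (M : manifold R m) (d1 d2 : nat)
  (f1 : 'I_d1 -> vector_field M) (f2 : 'I_d2 -> vector_field M)
  (J1 J2 : M -> R) (kappa1 kappa2 : R) (U : set M)
  (g : metric_tensor M) (nabla : connection M) (xstar : M)
  (Omega : set 'M[R]_(d1, d2)) (Xstar : 'M[R]_(d1, d2) -> M)
  (f1_smooth : forall j, smooth_field setT (f1 j))
  (f2_smooth : forall j, smooth_field setT (f2 j))
  (J1_smooth : smooth_fun setT J1)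
  (J2_smooth : smooth_fun setT J2)
  (kappa1_gt0 : 0 < kappa1)
  (kappa2_gt0 : 0 < kappa2)
  (U_open : open U)
  (E1_regular : regular_distribution U (span_fields f1))
  (E2_regular : regular_distribution U (span_fields f2))
  (E12_direct : forall x, U x ->
     directv (span_fields f1 x + span_fields f2 x)%VS)
  (E12_full : forall x, U x ->
     (span_fields f1 x + span_fields f2 x)%VS = fullv)
  (f1_free : forall x, U x -> free [seq f1 j x | j : 'I_d1])
  (f2_free : forall x, U x -> free [seq f2 j x | j : 'I_d2])
  (g_riemannian : riemannian_metric U g)
  (g_orthonormal : orthonormal_frame U g f1 f2)
  (nabla_levi_civita : levi_civita U g nabla)
  (U_xstar : U xstar)
  (xstar_stable :
     locally_exp_stable (seeking_dynamics kappa1 kappa2 J1 J2 f1 f2) xstar)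
  (Omega_open : open Omega)
  (Omega_0 : Omega 0)
  (Xstar_smooth : smooth_map Omega Xstar)
  (Xstar_U : forall gamma, Omega gamma -> U (Xstar gamma))
  (Xstar_0 : Xstar 0 = xstar)
  (Xstar_stable : forall gamma, Omega gamma ->
     locally_exp_stable
       (seeking_dynamics kappa1 kappa2 J1 J2 f1 (tilt gamma f1 f2))
       (Xstar gamma)) :
  let A := intrinsic_jacobian g nabla (span_fields f1) (span_fields f2)
             J1 J2 xstar in
  exists Ainv : 'rV[R]_m -> 'rV[R]_m,
    [/\ cancel A Ainv, cancel Ainv A &
        forall (j : 'I_d2) (k : 'I_d1),
          map_derive Xstar 0 (delta_mx k j) =
            - (diff_fun J2 xstar (f1 k xstar) *: Ainv (f2 j xstar))].
Proof.
move=> A; have oU := U_open.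
have sf1 k : smooth_field U (f1 k) by exact: sub_smooth_field (f1_smooth k).
have sf2 j : smooth_field U (f2 j) by exact: sub_smooth_field (f2_smooth j).
have sJ1 : smooth_fun U J1 by exact: sub_smooth_fun J1_smooth.
have sJ2 : smooth_fun U J2 by exact: sub_smooth_fun J2_smooth.
pose a k := lie_derivative (f1 k) J1; pose b j := lie_derivative (f2 j) J2.
pose c k := lie_derivative (f1 k) J2.
have sa k : smooth_fun U (a k) by exact: lie_derivative_smooth.
have sb j : smooth_fun U (b j) by exact: lie_derivative_smooth.
have sc k : smooth_fun U (c k) by exact: lie_derivative_smooth.
have equil gamma : Omega gamma -> (forall k, a k (Xstar gamma) = 0) /\
    (forall j, b j (Xstar gamma) + \sum_(k < d1) gamma k j * c k (Xstar gamma) = 0).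
  move=> Og; have [F0 _] := Xstar_stable _ Og.
  exact: (tilted_equilibrium g_riemannian g_orthonormal sJ2
            kappa1_gt0 kappa2_gt0 (Xstar_U _ Og) F0).
have [a0 b0] : (forall k, a k xstar = 0) /\ (forall j, b j xstar = 0).
  have [a0 b0] := equil 0 Omega_0; rewrite Xstar_0 in a0 b0; split=> // j.
  by have := b0 j; rewrite big1 ?addr0// => k _; rewrite mxE mul0r.
have [nablaA _ _] := nabla_levi_civita.
have derA := nabla_derivation _ U_xstar nablaA.
have AE v : A v = \sum_(k < d1) diff_fun (a k) xstar v *: f1 k xstar +
                  \sum_(j < d2) diff_fun (b j) xstar v *: f2 j xstar.
  rewrite /A /intrinsic_jacobian -[X in X + _]scale1r -[X in _ + X]scale1r.
  rewrite -(derivation_seeking oU sJ1 sJ2 sf1 sf2 1 1 U_xstar (derA v) a0 b0).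
  apply/esym/(eq_derivation oU U_xstar (derA v)).
    exact: seeking_smooth.
  move=> y Uy; apply/esym.
  exact: (grad_sum_seeking g_riemannian g_orthonormal sJ1 sJ2).
have Alin r u v : A (r *: u + v) = r *: A u + A v.
  have [Alin _ _ _] := nablaA; apply: Alin => //.
  apply: eq_smooth_field oU _ (seeking_smooth oU sJ1 sJ2 sf1 sf2 1 1) => y Uy.
  apply/esym; exact: (grad_sum_seeking g_riemannian g_orthonormal sJ1 sJ2).
have Ainj v : A v = 0 -> v = 0.
  rewrite AE => /(frame_free g_riemannian g_orthonormal U_xstar)[da0 db0].
  have derL := local_rep_derivation v oU U_xstar.
  apply: (exp_stable_derive_inj xstar_stable).
    apply: (smooth_field_diff _ (dom_chart_at xstar) U_xstar).
    exact: seeking_smooth.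
  rewrite (derivation_seeking oU sJ1 sJ2 sf1 sf2 _ _ U_xstar derL a0 b0).
  rewrite !big1 ?scaler0 ?addr0// => k _; by rewrite (da0, db0) scale0r.
have [Ainv [AK AinvK AinvZ]] := linear_inj_inverse Alin Ainj.
exists Ainv; split=> // j k; set w := delta_mx k j.
set X' := map_derive Xstar 0 w.
have along h (sh : smooth_fun U h) : differentiable (h \o Xstar) 0 /\
    'D_w (h \o Xstar) 0 = diff_fun h xstar X'.
  have := diff_fun_map w oU sh Omega_open Xstar_smooth Omega_0 (Xstar_U _ Omega_0).
  by rewrite Xstar_0.
have nearO : \forall gamma \near (0 : 'M[R]_(d1, d2)), Omega gamma.
  exact: open_nbhs_nbhs.
have da k' : diff_fun (a k') xstar X' = 0.
  rewrite -(along _ (sa k')).2 -(derive_cst (0 : R) (0 : 'M[R]_(d1, d2)) w).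
  apply: near_eq_derive; apply: filterS nearO => gamma /equil[+ _]; exact.
have db j' : diff_fun (b j') xstar X' = - ((j' == j)%:R * c k xstar).
  have [dbX DbX] := along _ (sb j').
  pose tilt_term := \sum_(k' < d1)
    (fun gamma : 'M[R]_(d1, d2) => gamma k' j') * (c k' \o Xstar).
  have dentry k' : derivable (fun gamma : 'M[R]_(d1, d2) => gamma k' j') 0 w.
    exact/diff_derivable/differentiable_coord.
  have dcX k' : derivable (c k' \o Xstar) 0 w.
    by apply/diff_derivable; have [] := along _ (sc k').
  have dterm k' : derivable ((fun gamma : 'M[R]_(d1, d2) => gamma k' j') *
      (c k' \o Xstar)) 0 w by exact: derivableM.
  have Dentry k' : 'D_w (fun gamma : 'M[R]_(d1, d2) => gamma k' j') 0 = w k' j'.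
    exact: derive_entry.
  have Dterm k' : 'D_w ((fun gamma : 'M[R]_(d1, d2) => gamma k' j') *
      (c k' \o Xstar)) 0 = c k' xstar * w k' j'.
    by rewrite (deriveM (dentry k') (dcX k')) Dentry mxE scale0r add0r /= Xstar_0.
  have DT : 'D_w tilt_term 0 = (j' == j)%:R * c k xstar.
    rewrite (derive_sum dterm); under eq_bigr do rewrite Dterm.
    rewrite (bigD1 k isT) big1 ?addr0 => [|k' /andP[_ /negbTE kk']].
      rewrite mxE eqxx; exact: (etrans (addr0 _) (mulrC _ _)).
    by rewrite mxE kk' mulr0.
  (* By [equil], b_{j'} + sum_{k'} gamma_{j'}^{k'} c_{k'} is constant along Xstar. *)
  apply/eqP; rewrite -addr_eq0 -DbX -DT -deriveD; first last.
  - exact: derivable_sum.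
  - exact: diff_derivable.
  rewrite -(derive_cst (0 : R) (0 : 'M[R]_(d1, d2)) w); apply/eqP.
  apply: near_eq_derive; apply: filterS nearO => gamma /equil[_ /(_ j')].
  by rewrite /tilt_term !fctE fct_sumE.
have AX : A X' = - (c k xstar *: f2 j xstar).
  rewrite AE big1 ?add0r; last by move=> k' _; rewrite da scale0r.
  rewrite (bigD1 j)//= big1 ?addr0.
    by rewrite db eqxx mul1r scaleNr.
  by move=> j' /negbTE jj'; rewrite db jj' mul0r oppr0 scale0r.
by rewrite -[LHS]AK AX -scaleN1r !AinvZ scaleN1r.
Qed.
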